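(* Let $\mathcal{X}=\{x_1,\dots,x_m\}\subset\mathbb{R}^n$ be an interpolation set with base point $x_0\in\mathbb{R}^n$, let $\Delta>0$ and $t\in\{1,\dots,n\}$. If $\mathcal{X}$ is $\Lambda$-poised in the Euclidean ball $\mathcal{B}(x_0,\Delta)$ centered at the base point $x_0$, then the flipped interpolation set $\hat{\mathcal{X}}=\{\hat x_1,\dots,\hat x_m\}$ generated by the $t$-axis flip about $x_0$ maintains the same poisedness constant $\Lambda$ in $\mathcal{B}(x_0,\Delta)$.
   Context: $\mathcal{B}(x_0,\Delta)=\{x\in\mathbb{R}^n:\|x-x_0\|\le\Delta\}$ (Euclidean norm), and $n+2\le m\le\frac12(n+1)(n+2)$. The $t$-axis flip about $x_0$ replaces each $x_i$ by $\hat x_i=x_0+F_t(x_i-x_0)$ with $F_t=I-2e_te_t^\top$, i.e. it negates the $t$-th coordinate of $x_i-x_0$. Poisedness is in the minimum Frobenius norm sense: $\mathcal{X}$ is poised if its KKT matrix $$W=\begin{pmatrix}A & X^\top \\ X & 0\end{pmatrix},\quad A_{ij}=\tfrac12\langle x_i-x_0,x_j-x_0\rangle^2,\quad X\in\mathbb{R}^{(n+1)\times m}\text{ with } i\text{-th column }(1,(x_i-x_0)^\top)^\top,$$ is nonsingular. In that case, the $i$-th minimum Frobenius norm Lagrange polynomial $\ell_i$ is the unique quadratic polynomial minimizing $\|\nabla^2\ell\|_F$ subject to $\ell(x_j)=\delta_{ij}$ for $j=1,\dots,m$. The poised set $\mathcal{X}$ is $\Lambda$-poised in a ball $\mathcal{B}$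 if $\max_{1\le i\le m}\sup_{x\in\mathcal{B}}|\ell_i(x)|\le\Lambda$; the smallest such $\Lambda$ is its poisedness constant in $\mathcal{B}$. *)

(* Defs.v *)
From HB Require Import structures.
From mathcomp Require Import all_boot all_order all_algebra.
From mathcomp Require Import mpoly.
From mathcomp Require Import boolp classical_sets reals.
From mathcomp Require Import constructive_ereal ereal.

Set Implicit Arguments.
Unset Strict Implicit.
Unset Printing Implicit Defensive.

Import Order.TTheory GRing.Theory Num.Theory.
Local Open Scope classical_set_scope.
Local Open Scope ring_scope.

Section MinimumFrobeniusNorm.
Variables (R : realType) (n m : nat).

Definition dotp (u v : 'cV[R]_n) : R := \sum_(k < n) u k 0 * v k 0.

(* The canonical norm of MathComp-Analysis on matrices is the max norm, hence
   the explicit Euclidean norm. *)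
Definition enorm (u : 'cV[R]_n) : R := Num.sqrt (dotp u u).

Definition eball (x0 : 'cV[R]_n) (D : R) : set 'cV[R]_n :=
  [set z | enorm (z - x0) <= D].

Definition frob_norm (H : 'M[R]_n) : R :=
  Num.sqrt (\sum_(i < n) \sum_(j < n) H i j ^+ 2).

Definition flip_mx (t : 'I_n) : 'M[R]_n :=
  let e : 'cV[R]_n := delta_mx t 0 in 1%:M - 2 *: (e *m e^T).

(* An interpolation set is given as the family of its points. *)
Definition flip_set (x0 : 'cV[R]_n) (t : 'I_n) (x : 'I_m -> 'cV[R]_n) :
    'I_m -> 'cV[R]_n :=
  fun i => x0 + flip_mx t *m (x i - x0).

Definition kkt_A (x0 : 'cV[R]_n) (x : 'I_m -> 'cV[R]_n) : 'M[R]_m :=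
  \matrix_(i, j) (2^-1 * dotp (x i - x0) (x j - x0) ^+ 2).

Definition kkt_X (x0 : 'cV[R]_n) (x : 'I_m -> 'cV[R]_n) : 'M[R]_(1 + n, m) :=
  col_mx (const_mx 1) (\matrix_(k < n, i < m) (x i - x0) k 0).

Definition kkt_mx (x0 : 'cV[R]_n) (x : 'I_m -> 'cV[R]_n) :
    'M[R]_(m + (1 + n)) :=
  block_mx (kkt_A x0 x) (kkt_X x0 x)^T (kkt_X x0 x) 0.

Definition poised (x0 : 'cV[R]_n) (x : 'I_m -> 'cV[R]_n) : Prop :=
  kkt_mx x0 x \in unitmx.

Definition peval (p : {mpoly R[n]}) (z : 'cV[R]_n) : R := p.@[fun k => z k 0].

(* Total degree at most 2: [msize] is the total degree plus one. *)
Definition quadratic (p : {mpoly R[n]}) : Prop := (msize p <= 3)%N.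

Definition hessian (p : {mpoly R[n]}) (z : 'cV[R]_n) : 'M[R]_n :=
  \matrix_(i, j) peval (mderiv j (mderiv i p)) z.

Definition lagrange_feasible (x : 'I_m -> 'cV[R]_n) (i : 'I_m)
    (p : {mpoly R[n]}) : Prop :=
  quadratic p /\ forall j : 'I_m, peval p (x j) = (i == j)%:R.

(* [p] is the unique minimizer.  The Hessian of a quadratic polynomial is
   constant, so that evaluating it at [x0] is immaterial. *)
Definition mfn_lagrange (x0 : 'cV[R]_n) (x : 'I_m -> 'cV[R]_n) (i : 'I_m)
    (p : {mpoly R[n]}) : Prop :=
  [/\ lagrange_feasible x i p,
      forall q, lagrange_feasible x i q ->
        frob_norm (hessian p x0) <= frob_norm (hessian q x0)
    & forall q, lagrange_feasible x i q ->
        frob_norm (hessian q x0) = frob_norm (hessian p x0) -> q = p].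

(* [mfn_lagrange x0 x i] determines [l i]; the supremum is taken in the
   extended reals, where it is always meaningful. *)
Definition lambda_poised (x0 : 'cV[R]_n) (D : R) (x : 'I_m -> 'cV[R]_n)
    (L : R) : Prop :=
  poised x0 x /\
  exists l : 'I_m -> {mpoly R[n]},
    (forall i, mfn_lagrange x0 x i (l i)) /\
    (\big[maxe/-oo]_(i < m)
        ereal_sup [set (`|peval (l i) z|)%:E | z in eball x0 D] <= L%:E)%E.

(* When some [L] is admissible and [0 < m], the infimum is attained: it is the smallest
   admissible [L]. *)
Definition poisedness_constant (x0 : 'cV[R]_n) (D : R) (x : 'I_m -> 'cV[R]_n) :
    R :=
  inf [set L : R | lambda_poised x0 D x L].

End MinimumFrobeniusNorm.

(* Main.v *)
Require Import Defs.
From HB Require Import structures.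
From mathcomp Require Import all_boot all_order all_algebra.
From mathcomp Require Import mpoly.
From mathcomp Require Import boolp classical_sets reals.
From mathcomp Require Import constructive_ereal ereal.

Set Implicit Arguments.
Unset Strict Implicit.
Unset Printing Implicit Defensive.

Import Order.TTheory GRing.Theory Num.Theory.
Local Open Scope ring_scope.

(** The flip is an orthogonal map about [x0], and everything in the definition
    of Lambda-poisedness is equivariant under orthogonal maps about [x0], so
    the result is proved for an arbitrary [Q] with [Q^T *m Q = 1%:M].  Write
    phi for the map [z |-> x0 + Q *m (z - x0)].

    Composition with phi carries polynomials of degree at most two to such
    polynomials, and it is bijective, with inverse composition with the map of
    [Q^T] ([comp_aboutK]).  It turns a polynomial satisfying the interpolation
    conditions on phi(X) into one satisfying them on X, and by the chain rule
    the Hessian is only conjugated by [Q], which preserves its Frobenius norm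
    ([hessian_about], [frob_norm_orthogonal]).  So the two minimization
    problems correspond, and the Lagrange polynomials of phi(X) are those of X
    composed with the inverse of phi ([mfn_lagrange_about]).  As phi maps the
    ball centred at [x0] onto itself, the suprema agree.  Poisedness itself is
    preserved because the two KKT matrices are congruent ([poised_about]).
    Hence every bound admissible for X is admissible for phi(X)
    ([lambda_poised_about]).

    The flip is moreover an involution, so the bounds admissible for the set
    and for its flip are exactly the same, and the smallest ones coincide. *)

(** * Composition of multivariate polynomials *)

(** Statements about evaluation-like morphisms only need checking on constants
    and variables; this spares the manipulation of monomials. *)
Lemma mpoly_ring_ind (R : comNzRingType) (n : nat) (P : {mpoly R[n]} -> Prop) :
    (forall c, P c%:MP) -> (forall i, P 'X_i) ->
    (forall p q, P p -> P q -> P (p + q)) ->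
    (forall p q, P p -> P q -> P (p * q)) ->
  forall p, P p.
Proof.
move=> PC PX PD PM; elim/mpolyind => [|c m p _ _ Pp]; first by rewrite -mpolyC0.
apply: PD => //; rewrite -mul_mpolyC; apply: (PM) => //.
rewrite mpolyXE_id.
apply: (big_ind P); [by rewrite -mpolyC1 | exact: PM | move=> i _].
elim: (m i) => [|k IHk]; first by rewrite expr0 -mpolyC1.
by rewrite exprS; apply: (PM).
Qed.

Lemma comp_mpolyA (R : comNzRingType) (n k l : nat) (p : {mpoly R[n]})
    (f : n.-tuple {mpoly R[k]}) (g : k.-tuple {mpoly R[l]}) :
  (p \mPo f) \mPo g = p \mPo [tuple tnth f i \mPo g | i < n].
Proof.
elim/mpoly_ring_ind: p => [c|i|p q IHp IHq|p q IHp IHq].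
- by rewrite !comp_mpolyC.
- by rewrite !comp_mpolyXU -!tnth_nth tnth_mktuple.
- by rewrite !comp_mpolyD IHp IHq.
- by rewrite !rmorphM /= IHp IHq.
Qed.

Lemma mderivXU (R : nzRingType) (n : nat) (i j : 'I_n) :
  ('X_j : {mpoly R[n]})^`M(i) = (j == i)%:R.
Proof.
rewrite mderivX mnm1E; case: eqVneq => [->|_]; last by rewrite scale0r.
by rewrite scale1r -[X in (X - _)%MM]add0m addmK mpolyX0.
Qed.

(** The chain rule; for a product it reduces to the Leibniz rule. *)
Lemma mderiv_comp_mpoly (R : comNzRingType) (n k : nat) (p : {mpoly R[n]})
    (f : n.-tuple {mpoly R[k]}) (i : 'I_k) :
  (p \mPo f)^`M(i) = \sum_(j < n) (p^`M(j) \mPo f) * (tnth f j)^`M(i).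
Proof.
elim/mpoly_ring_ind: p => [c|h|p q IHp IHq|p q IHp IHq].
- rewrite comp_mpolyC mderivC big1 // => j _.
  by rewrite mderivC comp_mpoly0 mul0r.
- rewrite comp_mpolyXU -tnth_nth (bigD1 h) //= big1 => [|j neq_jh].
    by rewrite addr0 mderivXU eqxx comp_mpoly1 mul1r.
  by rewrite mderivXU eq_sym (negPf neq_jh) comp_mpoly0 mul0r.
- rewrite comp_mpolyD mderivD IHp IHq -big_split; apply: eq_bigr => j _ /=.
  by rewrite mderivD comp_mpolyD mulrDl.
- rewrite rmorphM /= mderivM IHp IHq mulr_suml mulr_sumr -big_split.
  apply: eq_bigr => j _ /=.
  by rewrite mderivM comp_mpolyD !rmorphM /= mulrDl mulrAC !mulrA.
Qed.

(** Each monomial of [p] becomes a product of as many affine factors as its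
    degree.  The domain hypothesis gives the exact size of a product. *)
Lemma msize_comp_affine (R : idomainType) (n k : nat) (p : {mpoly R[n]})
    (f : n.-tuple {mpoly R[k]}) :
  (forall i, (msize (tnth f i) <= 2)%N) -> (msize (p \mPo f) <= msize p)%N.
Proof.
move=> f_aff.
have msizeM_bound a b (u v : {mpoly R[k]}) :
    (msize u <= a.+1)%N -> (msize v <= b.+1)%N ->
    (msize (u * v) <= (a + b).+1)%N.
  have [->|u0] := eqVneq u 0; first by rewrite mul0r msize0.
  have [->|v0] := eqVneq v 0; first by rewrite mulr0 msize0.
  rewrite msizeM // => ua vb.
  by rewrite -ltnS prednK ?addn_gt0 ?lt0n ?msize_poly_eq0 ?u0 //
             -addSn -addnS leq_add.
rewrite comp_mpolyEX; apply: (leq_trans (msize_sum _ _ _)).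
apply/bigmax_leqP_seq => m m_p _.
apply: leq_trans (msizeZ_le _ _) _.
apply: leq_trans (msize_mdeg_lt m_p).
rewrite comp_mpolyX mdegE.
elim/big_rec2: _ => [|i d u _ IH]; first by rewrite -mpolyC1 msizeC leq_b1.
apply: (msizeM_bound) => //.
elim: (m i) => [|e IHe]; first by rewrite expr0 -mpolyC1 msizeC leq_b1.
by rewrite exprS; apply: (msizeM_bound 1 e).
Qed.

(** * Maps with linear part [Q] fixing the base point *)

Section OrthogonalInvariance.
Variables (R : realType) (n : nat) (x0 : 'cV[R]_n).
Implicit Types (Q : 'M[R]_n) (z u v : 'cV[R]_n) (p : {mpoly R[n]}).

Definition about Q z : 'cV[R]_n := x0 + Q *m (z - x0).

(** The coordinates of [about Q] as polynomials, so that [p \mPo about_mpoly Q]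
    represents [p] precomposed with [about Q]. *)
Definition about_mpoly Q : n.-tuple {mpoly R[n]} :=
  [tuple (x0 k 0)%:MP + \sum_(j < n) Q k j *: ('X_j - (x0 j 0)%:MP) | k < n].

Lemma about_sub Q z : about Q z - x0 = Q *m (z - x0).
Proof. by rewrite /about addrC addKr. Qed.

Lemma about_base Q : about Q x0 = x0.
Proof. by rewrite /about subrr mulmx0 addr0. Qed.

Lemma aboutK Q Q' : Q' *m Q = 1%:M -> cancel (about Q) (about Q').
Proof.
by move=> QQ z; rewrite {1}/about about_sub mulmxA QQ mul1mx addrC subrK.
Qed.

Lemma peval_about Q p z : peval (p \mPo about_mpoly Q) z = peval p (about Q z).
Proof.
rewrite /peval comp_mpoly_meval; apply: meval_eq => k.
rewrite tnth_mktuple mevalD mevalC !mxE; congr (_ + _).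
rewrite raddf_sum /=; apply: eq_bigr => j _.
by rewrite mevalZ mevalB mevalXU mevalC !mxE.
Qed.

(** An identity of polynomials and not only of their values, as uniqueness of
    the Lagrange polynomials requires. *)
Lemma comp_aboutK Q Q' p :
  Q *m Q' = 1%:M -> (p \mPo about_mpoly Q) \mPo about_mpoly Q' = p.
Proof.
move=> QQ; rewrite comp_mpolyA -[RHS]comp_mpoly_id; congr (_ \mPo _).
apply: eq_from_tnth => k; rewrite !tnth_mktuple comp_mpolyD comp_mpolyC.
rewrite raddf_sum /=.
under eq_bigr => j _.
  rewrite comp_mpolyZ comp_mpolyB comp_mpolyXU comp_mpolyC -tnth_nth.
  rewrite tnth_mktuple addrC addKr scaler_sumr.
  under eq_bigr => l _ do rewrite scalerA.
  over.
rewrite exchange_big /=.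
under eq_bigr => l _.
  rewrite -scaler_suml (_ : \sum_j _ = (Q *m Q') k l); last by rewrite mxE.
  rewrite QQ mxE.
  over.
rewrite (bigD1 k) //= eqxx scale1r big1 ?addr0 => [|l neq_lk].
  by rewrite addrC subrK.
by rewrite eq_sym (negPf neq_lk) scale0r.
Qed.

Lemma msize_about Q k : (msize (tnth (about_mpoly Q) k) <= 2)%N.
Proof.
have szC c : (msize (c%:MP : {mpoly R[n]}) <= 2)%N.
  by rewrite msizeC; case: (c != 0).
have szD (u v : {mpoly R[n]}) :
    (msize u <= 2)%N -> (msize v <= 2)%N -> (msize (u + v) <= 2)%N.
  by move=> su sv; apply: leq_trans (msizeD_le _ _) _; rewrite geq_max su.
rewrite tnth_mktuple; apply: (szD) => //.
elim/big_ind: _ => [|u v su sv|j _]; [by rewrite msize0 | exact: szD |].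
apply: leq_trans (msizeZ_le _ _) _; apply: (szD); last by rewrite -mpolyCN.
by rewrite msizeX mdeg1.
Qed.

Lemma mderiv_about Q p i :
  (p \mPo about_mpoly Q)^`M(i) =
  \sum_(k < n) Q k i *: (p^`M(k) \mPo about_mpoly Q).
Proof.
rewrite mderiv_comp_mpoly; apply: eq_bigr => k _.
suff -> : (tnth (about_mpoly Q) k)^`M(i) = (Q k i)%:MP.
  by rewrite mulrC mul_mpolyC.
rewrite tnth_mktuple mderivD mderivC add0r raddf_sum /= (bigD1 i) //=.
rewrite big1 ?addr0 => [|j neq_ji];
  rewrite mderivZ mderivB mderivC subr0 mderivXU.
  by rewrite eqxx -mul_mpolyC mulr1.
by rewrite (negPf neq_ji) scaler0.
Qed.

Lemma hessian_about Q p z :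
  hessian (p \mPo about_mpoly Q) z = Q^T *m hessian p (about Q z) *m Q.
Proof.
have d2 i j : (p \mPo about_mpoly Q)^`M(i)^`M(j) = \sum_(l < n) \sum_(k < n)
    (Q k i * Q l j) *: (p^`M(k)^`M(l) \mPo about_mpoly Q).
  rewrite mderiv_about (raddf_sum (mderiv j)) exchange_big.
  apply: eq_bigr => k _ /=; rewrite mderivZ mderiv_about scaler_sumr.
  by apply: eq_bigr => l _; rewrite scalerA.
apply/matrixP => i j; rewrite !mxE d2 /peval raddf_sum; apply: eq_bigr => l _.
rewrite !mxE mulr_suml raddf_sum; apply: eq_bigr => k _ /=.
by rewrite !mxE mevalZ -/(peval _ z) peval_about mulrAC.
Qed.

(** The squared norm is the trace of [H *m H^T], and the trace is cyclic. *)
Lemma frob_norm_orthogonal Q (H : 'M[R]_n) :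
  Q^T *m Q = 1%:M -> frob_norm (Q^T *m H *m Q) = frob_norm H.
Proof.
move=> QQ; have frobE (G : 'M[R]_n) : frob_norm G = Num.sqrt (\tr (G *m G^T)).
  congr Num.sqrt; apply: eq_bigr => i _; rewrite mxE; apply: eq_bigr => j _.
  by rewrite mxE expr2.
have QQ' := mulmx1C QQ; rewrite !frobE; congr Num.sqrt.
rewrite !trmx_mul trmxK -!mulmxA (mulmxA Q) QQ' mul1mx mxtrace_mulC.
by rewrite -!mulmxA QQ' mulmx1.
Qed.

Lemma dotp_orthogonal Q u v :
  Q^T *m Q = 1%:M -> dotp (Q *m u) (Q *m v) = dotp u v.
Proof.
move=> QQ; have dotpE (a b : 'cV[R]_n) : dotp a b = (a^T *m b) 0 0.
  by rewrite mxE; apply: eq_bigr => k _; rewrite mxE.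
by rewrite !dotpE trmx_mul mulmxA -(mulmxA u^T) QQ mulmx1.
Qed.

Lemma eball_about Q D z :
  Q^T *m Q = 1%:M -> eball x0 D (about Q z) <-> eball x0 D z.
Proof. by move=> QQ; rewrite /eball /= about_sub /enorm dotp_orthogonal. Qed.

(** * Equivariance of Lambda-poisedness *)

Variable m : nat.
Implicit Types (x : 'I_m -> 'cV[R]_n).

(** The block A only involves inner products of displacements, hence does not
    change, while X is multiplied on the left by diag(1, Q).  The KKT matrix is
    therefore transformed by congruence with diag(1, 1, Q). *)
Lemma poised_about Q x :
  Q^T *m Q = 1%:M -> poised x0 x -> poised x0 (about Q \o x).
Proof.
move=> QQ; rewrite /poised.
pose C : 'M[R]_(1 + n) := block_mx 1%:M 0 0 Q.
pose B : 'M[R]_(m + (1 + n)) := block_mx 1%:M 0 0 C.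
have uQ : Q \in unitmx by case/mulmx1_unit: QQ.
have uB : B \in unitmx by rewrite unitmxE !det_ublock !det1 !mul1r -unitmxE.
have XE : kkt_X x0 (about Q \o x) = C *m kkt_X x0 x.
  rewrite /kkt_X mul_block_col !mul1mx !mul0mx addr0 add0r; congr col_mx.
  apply/matrixP => k i; rewrite [LHS]mxE /= about_sub !mxE.
  by apply: eq_bigr => l _; rewrite !mxE.
have AE : kkt_A x0 (about Q \o x) = kkt_A x0 x.
  by apply/matrixP => i j; rewrite !mxE /= !about_sub dotp_orthogonal.
have -> : kkt_mx x0 (about Q \o x) = B *m kkt_mx x0 x *m B^T.
  rewrite /kkt_mx XE AE tr_block_mx !mulmx_block.
  by rewrite !trmx1 !trmx0 !mul1mx !mul0mx !mulmx0 !mulmx1 !addr0 !add0r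
             trmx_mul mul0mx.
by move=> uW; rewrite !unitmx_mul uB uW unitmx_tr uB.
Qed.

Lemma feasible_about Q x i p :
  lagrange_feasible (about Q \o x) i p ->
  lagrange_feasible x i (p \mPo about_mpoly Q).
Proof.
case=> p_quad p_x; split=> [|j]; last by rewrite peval_about p_x.
by apply: leq_trans p_quad; apply: msize_comp_affine; apply: msize_about.
Qed.

(** Composition with [about Q] sends the competitors for the transformed set
    to competitors for [x] with the same Hessian norm.  Minimality follows at
    once; for uniqueness, a minimizer [q] composed with [about Q] must be [p],
    and composing back recovers [q]. *)
Lemma mfn_lagrange_about Q x i p :
  Q^T *m Q = 1%:M -> mfn_lagrange x0 x i p ->
  mfn_lagrange x0 (about Q \o x) i (p \mPo about_mpoly Q^T).
Proof.
move=> QQ [p_feas p_min p_uniq]; have QQ' := mulmx1C QQ.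
have frobE q : frob_norm (hessian (q \mPo about_mpoly Q) x0) =
               frob_norm (hessian q x0).
  by rewrite hessian_about frob_norm_orthogonal // about_base.
have frobpE : frob_norm (hessian (p \mPo about_mpoly Q^T) x0) =
              frob_norm (hessian p x0).
  by rewrite -frobE comp_aboutK.
split=> [|q /feasible_about q_feas|q /feasible_about q_feas].
(* [x] is the image under [about Q^T] of the transformed set. *)
- apply: feasible_about.
  rewrite (_ : _ \o _ = x) //; apply/funext => j /=; exact: aboutK.
- by rewrite frobpE -(frobE q) p_min.
- by rewrite frobpE -(frobE q) => /(p_uniq _ q_feas) <-; rewrite comp_aboutK.
Qed.

Lemma lambda_poised_about Q D x L :
  Q^T *m Q = 1%:M -> lambda_poised x0 D x L ->
  lambda_poised x0 D (about Q \o x) L.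
Proof.
move=> QQ [x_poised [l [l_mfn l_le]]]; have QQ' := mulmx1C QQ.
split; first exact: poised_about.
exists (fun i => l i \mPo about_mpoly Q^T); split=> [i|].
  exact: mfn_lagrange_about.
rewrite (eq_bigr _ (fun i _ => _ : _ = ereal_sup
  [set (`|peval (l i) z|)%:E | z in eball x0 D]%classic)) // => i _.
(* Both inclusions hold because [about Q] permutes the ball. *)
congr ereal_sup; apply/seteqP; split=> _ [z Dz <-].
  exists (about Q^T z); last by rewrite peval_about.
  by apply/eball_about; rewrite ?trmxK.
exists (about Q z); first exact/eball_about.
by rewrite peval_about aboutK.
Qed.

End OrthogonalInvariance.

(** * The axis flip *)

Lemma flip_mx_tr (R : realType) (n : nat) (t : 'I_n) :
  (flip_mx R t)^T = flip_mx R t.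
Proof. by rewrite /flip_mx linearB linearZ /= trmx1 trmx_mul trmxK. Qed.

Lemma flip_mxK (R : realType) (n : nat) (t : 'I_n) :
  flip_mx R t *m flip_mx R t = 1%:M.
Proof.
rewrite /flip_mx /=; set e := delta_mx t 0; set E := e *m e^T.
(* [E] is the orthogonal projection on the axis, so (1 - 2E)^2 = 1. *)
have EE : E *m E = E.
  rewrite /E mulmxA -(mulmxA e) trmx_delta mul_delta_mx.
  by rewrite (_ : delta_mx 0 0 = 1%:M) ?mulmx1 //; apply/matrixP=> i j;
     rewrite !ord1 !mxE.
rewrite mulmxBr mulmx1 mulmxBl mul1mx -scalemxAl -scalemxAr EE.
by rewrite [2 *: (2 *: E)]scaler_nat (mulr2n (2 *: E)) opprB addrK subrK.
Qed.

Theorem theorem3p1 (R : realType) (n m : nat)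
    (hm : (n + 2 <= m)%N) (hm' : (m <= ((n + 1) * (n + 2)) %/ 2)%N)
    (x0 : 'cV[R]_n) (x : 'I_m -> 'cV[R]_n) (D : R) (hD : 0 < D) (t : 'I_n)
    (L : R) (hx : lambda_poised x0 D x L) :
  lambda_poised x0 D (flip_set x0 t x) L /\
  poisedness_constant x0 D (flip_set x0 t x) = poisedness_constant x0 D x.
Proof.
have FF : (flip_mx R t)^T *m flip_mx R t = 1%:M by rewrite flip_mx_tr flip_mxK.
have flip_poised y M : lambda_poised x0 D y M ->
    lambda_poised x0 D (flip_set x0 t y) M.
  exact: lambda_poised_about.
split; first exact: flip_poised.
congr inf; apply/seteqP; split=> M /=; last exact: flip_poised.
move/flip_poised; rewrite (_ : flip_set x0 t (flip_set x0 t x) = x) //.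
by apply/funext => i; apply: (aboutK x0 (flip_mxK R t)).
Qed.
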